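(* There are universal constants $\varepsilon_0>0$, $c>0$ and $\kappa_0\ge 1$ such that for every $\kappa\ge\kappa_0$ the following holds. Let $\mathcal{F}_\kappa$ be the class of probability distributions $\pi\propto \exp(-V)$ on $\mathbb{R}^2$ such that $V:\mathbb{R}^2\to\mathbb{R}$ is $1$-strongly convex, $\kappa$-smooth, and minimized at $0$. Any (adaptive, possibly randomized) query algorithm that, for every $\pi\in\mathcal{F}_\kappa$, outputs a sample whose law is within total variation distance $\varepsilon_0$ of $\pi$ must make at least $c\log\kappa$ queries. In other words, the query complexity of sampling from this class to accuracy $\varepsilon_0$ in total variation distance is $\Omega(\log\kappa)$.
   Context: Potentials $V$ are twice continuously differentiable. Query model: the algorithm does not know $V$ but may query points $x\in\mathbb{R}^2$ and receives $(V(x),\nabla V(x))$, where $V$ is specified up to an additive constant (e.g. normalized by $V(0)=0$). Each query point may depend on all previous queries and answers and on a random seed independent of $V$; after at most $n$ queries the algorithm outputs a random point. The algorithm may know $\kappa$. The query complexity is the smallest $n$ for which an algorithm meeting the accuracy requirement for every target in the class exists. $V$ is $\beta$-smooth if $\nabla V$ is $\beta$-Lipschitz. *)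

(* Defs.v *)
From HB Require Import structures.
From mathcomp Require Import all_boot all_order all_algebra.
From mathcomp Require Import all_classical all_reals all_analysis.
Import Order.TTheory GRing.Theory Num.Theory.
Import numFieldNormedType.Exports.

Set Implicit Arguments.
Unset Strict Implicit.
Unset Printing Implicit Defensive.

Local Open Scope classical_set_scope.
Local Open Scope ring_scope.

(* The library norm on [R * R] is the sup norm; it is used below only through
   the topology (limits, derivatives).  All metric conditions on potentials use
   the Euclidean norm. *)
Definition enorm (R : realType) (x : R * R) : R :=
  Num.sqrt (x.1 ^+ 2 + x.2 ^+ 2).

Definition d1 (R : realType) (f : R * R -> R) : R * R -> R :=
  fun x => 'D_((1, 0) : R * R) f x.

Definition d2 (R : realType) (f : R * R -> R) : R * R -> R :=
  fun x => 'D_((0, 1) : R * R) f x.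

Definition grad (R : realType) (f : R * R -> R) (x : R * R) : R * R :=
  (d1 f x, d2 f x).

(* [derive] is a total operator, so the existence of the partial derivatives
   has to be required separately. *)
Definition C1 (R : realType) (f : R * R -> R) : Prop :=
  [/\ forall x, derivable f x ((1, 0) : R * R),
      forall x, derivable f x ((0, 1) : R * R),
      continuous (d1 f) & continuous (d2 f)].

Definition C2 (R : realType) (f : R * R -> R) : Prop :=
  [/\ C1 f, C1 (d1 f) & C1 (d2 f)].

Definition strongly_convex (R : realType) (alpha : R) (V : R * R -> R) : Prop :=
  forall (x y : R * R) (t : R), 0 <= t -> t <= 1 ->
    V (t *: x + (1 - t) *: y) <=
      t * V x + (1 - t) * V y
        - alpha / 2 * (t * (1 - t)) * enorm (x - y) ^+ 2.

Definition smooth (R : realType) (beta : R) (V : R * R -> R) : Prop :=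
  forall x y : R * R, enorm (grad V x - grad V y) <= beta * enorm (x - y).

(* The class of targets, described through the potentials; a target determines
   its potential up to an additive constant, to which [gibbs] and [oracle]
   below are insensitive. *)
Definition potential_class (R : realType) (kappa : R) : set (R * R -> R) :=
  [set V | [/\ C2 V, strongly_convex 1 V, smooth kappa V
             & forall x, V 0 <= V x]].

(* [R * R] with the product of the Borel sigma-algebras. *)
Definition plane (R : realType) := (measurableTypeR R * measurableTypeR R)%type.

Definition gibbs_weight (R : realType) (V : R * R -> R) (A : set (plane R))
    : \bar R :=
  (\int[@lebesgue_measure R \x @lebesgue_measure R]_(x in A)
     (expR (- V x))%:E)%E.

(* The distribution with density proportional to [exp (- V)].  For [V] in
   [potential_class kappa] the total weight is finite and positive, so that
   [fine] loses nothing. *)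
Definition gibbs (R : realType) (V : R * R -> R) (A : set (plane R)) : \bar R :=
  (((fine (gibbs_weight V [set: plane R]))^-1)%:E * gibbs_weight V A)%E.

Definition tv_dist (R : realType) (d : measure_display) (T : measurableType d)
    (P Q : set T -> \bar R) : \bar R :=
  ereal_sup [set `|P A - Q A|%E | A in [set A : set T | measurable A]].

(* The potential is revealed only up to an additive constant: values are
   normalized to vanish at the origin. *)
Definition oracle (R : realType) (V : R * R -> R) (x : R * R) : R * (R * R) :=
  (V x - V 0, grad V x).

(* Query points with the answers received, in chronological order. *)
Definition transcript (R : realType) := seq ((R * R) * (R * (R * R))).

(* An adaptive randomized algorithm with seeds in [Omega].  Given the seed and
   the transcript so far, [next_query] returns the next query point, or [None]
   to stop querying; [output] is applied to the final transcript. *)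
Record query_algorithm (R : realType) (Omega : Type) := QueryAlgorithm {
  next_query : Omega -> transcript R -> option (R * R) ;
  output : Omega -> transcript R -> R * R }.

(* Continues the interaction from the transcript [h] for at most [n] further
   queries. *)
Fixpoint interact (R : realType) (Omega : Type) (alg : query_algorithm R Omega)
    (V : R * R -> R) (w : Omega) (n : nat) (h : transcript R) : transcript R :=
  if n is n'.+1 then
    if next_query alg w h is Some x then
      interact alg V w n' (rcons h (x, oracle V x))
    else h
  else h.

Definition run (R : realType) (Omega : Type) (alg : query_algorithm R Omega)
    (V : R * R -> R) (n : nat) (w : Omega) : plane R :=
  output alg w (interact alg V w n [::]).

(* With at most [n] queries and seed distribution [P], the algorithm achieves
   accuracy [eps] in total variation on every target of the class.  The only
   measurability imposed on the algorithm is that its output be a random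
   point, so that it has a law. *)
Definition samples_within (R : realType) (d : measure_display)
    (Omega : measurableType d) (P : probability Omega R)
    (alg : query_algorithm R Omega) (n : nat) (kappa eps : R) : Prop :=
  forall V : R * R -> R, potential_class kappa V ->
    measurable_fun [set: Omega] (run alg V n) /\
    (tv_dist (pushforward P (run alg V n)) (gibbs V) <= eps%:E)%E.

(* Main.v *)
Require Import Defs.
From HB Require Import structures.
From mathcomp Require Import all_boot all_order all_algebra.
From mathcomp Require Import all_classical all_reals all_analysis.
From mathcomp Require Import measurable_realfun ring lra zify.
Import Order.TTheory GRing.Theory Num.Theory.
Import numFieldNormedType.Exports.
Local Open Scope classical_set_scope.
Local Open Scope ring_scope.

Set Implicit Arguments.
Unset Strict Implicit.
Unset Printing Implicit Defensive.

(* A word [th] of [K] bits encodes a ray through the origin, of slope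
   [axis th], via nested sectors of width [4 ^- k].  The potential
   [valley th] is [|p|^2 / 2] plus a convex function which vanishes near that
   ray and confines [gibbs (valley th)] to a cone of width [4 ^- K] around it;
   the [2 ^ K] cones are disjoint, and each carries a fixed fraction of its
   measure.  The convex function is a sum of ridge functions arranged so that, in
   each sector, the total slope jump and its barycenter do not depend on the
   deeper bits: a query outside of a sector cannot see those bits.  A query
   thus follows one path in the binary tree, and its answer depends only on where
   [th] leaves that path.  Hence [n] queries identify at most
   [2 ^ n (3 / 2) ^ K] of the [2 ^ K] words, while sampling forces a fixed
   fraction of them to be identified, so [n] is at least of order [K].  Since
   [valley th] is [400 ^ (K + 1)]-smooth, [K] can be taken of order [log kappa]. *)

(** * Convex functions of one variable and a smoothed positive part *)

Section MeanValue.
Context {R : realType}.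
Implicit Types f df : R -> R.

Lemma mean_value f df (x y : R) : (forall t : R, is_derive t 1 f (df t)) ->
  x <= y -> exists2 c, x <= c <= y & f y - f x = df c * (y - x).
Proof.
move=> fdf xy.
have cf : {within `[x, y], continuous f}.
  by apply: derivable_within_continuous => t _; have [] := fdf t.
have [c cxy fE] := MVT_segment xy (fun t _ => fdf t) cf.
by exists c => //; rewrite in_itv/= in cxy.
Qed.

Lemma derive_lipschitz f df (k : R) : (forall t : R, is_derive t 1 f (df t)) ->
  (forall t, `|df t| <= k) -> forall x y, `|f x - f y| <= k * `|x - y|.
Proof.
move=> fdf dfk x y; wlog xy : x y / x <= y.
  by move=> H; have [/H//|/ltW/H] := leP x y; rewrite distrC (distrC y).
have [c _ fE] := mean_value fdf xy.
by rewrite distrC fE normrM (distrC x) ler_wpM2r.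
Qed.

Lemma derive_ge0_homo f df : (forall t : R, is_derive t 1 f (df t)) ->
  (forall t, 0 <= df t) -> {homo f : x y / x <= y}.
Proof.
move=> fdf df0 x y xy; have [c _ fE] := mean_value fdf xy.
by rewrite -subr_ge0 fE mulr_ge0 ?subr_ge0.
Qed.

Lemma tangent_le f df : (forall t : R, is_derive t 1 f (df t)) ->
  {homo df : x y / x <= y} -> forall x y, f x + df x * (y - x) <= f y.
Proof.
move=> fdf mdf x y; have [xy|/ltW yx] := leP x y.
  have [c /andP[xc _] fE] := mean_value fdf xy.
  have := mdf _ _ xc; have : 0 <= y - x by rewrite subr_ge0.
  by nra.
have [c /andP[_ cx] fE] := mean_value fdf yx.
have := mdf _ _ cx; have : 0 <= x - y by rewrite subr_ge0.
by nra.
Qed.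

End MeanValue.

Section SmoothedPositivePart.
Context {R : realType}.
Implicit Types t : R.

Definition relu t : R := Num.max t 0.

Lemma ger0_relu t : 0 <= t -> relu t = t.
Proof. by move=> t0; apply/max_idPl. Qed.

Lemma ler0_relu t : t <= 0 -> relu t = 0.
Proof. by move=> t0; apply/max_idPr. Qed.

Lemma relu_continuous : continuous relu.
Proof. by move=> t; apply: continuous_max; [exact: cvg_id|exact: cvg_cst]. Qed.

Lemma relu_mul t : relu t * t = relu t ^+ 2.
Proof.
have [t0|/ltW t0] := leP 0 t; first by rewrite ger0_relu.
by rewrite ler0_relu// mul0r expr0n.
Qed.

(** The first-order remainder of [relu ^+ 2] lies between [0] and [h ^+ 2], even when [0] separates
    [t] from [h + t], so the difference quotient is within [|h|] of its limit. *)
Lemma is_derive_relu2 t : is_derive t 1 (fun s => relu s ^+ 2) (2 * relu t).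
Proof.
have H : (fun h => h^-1 *: (relu (h *: 1 + t) ^+ 2 - relu t ^+ 2)) @ 0^' -->
    2 * relu t.
  apply/cvgrPdist_le => e e0; near=> h.
  have h0 : h != 0 by near: h; exact: nbhs_dnbhs_neq.
  have he : `|h| <= e.
    by near: h; apply: dnbhs0_le.
  apply: le_trans he.
  rewrite -[X in `|X|](mulfK h0) normrM normfV ler_pdivrMr ?normr_gt0//.
  rewrite -normrM -expr2 (_ : _ * h = - (relu (h + t) ^+ 2 - relu t ^+ 2
    - 2 * relu t * h)); last first.
    by rewrite /GRing.scale/= mulr1 mulrBl (mulrAC h^-1) mulVf// mul1r; ring.
  rewrite normrN ger0_norm ?sqr_ge0//.
  have [t0|/ltW t0] := leP 0 t; have [s0|/ltW s0] := leP 0 (h + t);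
    rewrite ?(ger0_relu t0) ?(ler0_relu t0) ?(ger0_relu s0) ?(ler0_relu s0)
      ler_norml; apply/andP; split; nra.
split; first by apply/cvg_ex; exists (2 * relu t).
exact/cvg_lim.
Unshelve. all: by end_near. Qed.

Lemma is_derive_relu3 t : is_derive t 1 (fun s => relu s ^+ 3) (3 * relu t ^+ 2).
Proof.
have -> : (fun s => relu s ^+ 3) = (fun s => relu s ^+ 2 * s).
  by apply/funext => s; rewrite expr2 -mulrA relu_mul -exprS.
have := @is_deriveM R R (fun s => relu s ^+ 2) id t 1 _ _
  (is_derive_relu2 t) (is_derive_id _ _).
move=> /is_derive_eq; apply.
rewrite /GRing.scale/= mulr1 mulrCA (mulrC t) relu_mul; ring.
Qed.

(** Second central difference of a truncated power; [spline 1] is the hat function supported on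
    [-1, 1]. *)
Definition spline n t : R := relu (t + 1) ^+ n - 2 * relu t ^+ n + relu (t - 1) ^+ n.

(* The third iterated integral of [delta_(-1) - 2 delta_0 + delta_1]; it agrees
   with the positive part outside of [-1, 1]. *)
Definition psi t : R := spline 3 t / 6.
Definition dpsi t : R := spline 2 t / 2.
Definition ddpsi t : R := spline 1 t.

(** Differences commute with differentiation. The power rule is a hypothesis because it fails for
    [relu] itself. *)
Lemma is_derive_spline n k t :
  (forall s : R, is_derive s 1 (fun s => relu s ^+ n.+1) (k * relu s ^+ n)) ->
  is_derive t 1 (spline n.+1) (k * spline n t).
Proof.
move=> H.
have D (a : R) : is_derive t 1 (fun s => relu (s + a) ^+ n.+1)
    (k * relu (t + a) ^+ n).
  have sh : is_derive t 1 (fun s => s + a) 1.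
    have := @is_deriveD R _ _ id (cst a) t 1 _ _ (is_derive_id _ _)
      (is_derive_cst _ _ _).
    by rewrite addr0.
  have := @is_derive1_comp _ (fun s => relu s ^+ n.+1) (fun s => s + a) t _ _
     (H _) sh.
  by rewrite mulr1.
have D1 := is_deriveD (is_deriveB (D 1) (is_deriveZ 2 (H t))) (D (-1)).
apply: is_derive_eq D1 _.
by rewrite /spline /GRing.scale/=; ring.
Qed.

Lemma is_derive_psi t : is_derive t 1 psi (dpsi t).
Proof.
have -> : psi = 6^-1 *: spline 3 :> (R -> R).
  by apply/funext => s; rewrite /psi mulrC.
apply: is_derive_eq (is_deriveZ 6^-1 (is_derive_spline t is_derive_relu3)) _.
by rewrite /GRing.scale/= /dpsi; field.
Qed.

Lemma is_derive_dpsi t : is_derive t 1 dpsi (ddpsi t).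
Proof.
have -> : dpsi = 2^-1 *: spline 2 :> (R -> R).
  by apply/funext => s; rewrite /dpsi mulrC.
apply: is_derive_eq (is_deriveZ 2^-1 (is_derive_spline t is_derive_relu2)) _.
by rewrite /GRing.scale/= /ddpsi; field.
Qed.

Lemma ddpsi_ge0 t : 0 <= ddpsi t.
Proof.
rewrite /ddpsi /spline !expr1 /relu.
by case: (leP (t + 1) 0); case: (leP t 0); case: (leP (t - 1) 0); lra.
Qed.

Lemma ddpsi_le1 t : ddpsi t <= 1.
Proof.
rewrite /ddpsi /spline !expr1 /relu.
by case: (leP (t + 1) 0); case: (leP t 0); case: (leP (t - 1) 0); lra.
Qed.

Lemma ddpsi_continuous : continuous ddpsi.
Proof.
move=> t; have cr (a : R) : {for t, continuous (fun s => relu (s + a))}.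
  apply: continuous_comp; last exact: relu_continuous.
  by apply: cvgD; [exact: cvg_id|exact: cvg_cst].
rewrite /ddpsi /spline; apply: cvgD; first apply: cvgB.
- exact: cr.
- by apply: cvgM; [exact: cvg_cst|exact: relu_continuous].
- exact: cr.
Qed.

Lemma psi_eq0 t : t <= -1 -> psi t = 0.
Proof.
move=> t1; rewrite /psi /spline !ler0_relu; [|lra..].
by rewrite !expr0n/=; ring.
Qed.

Lemma psi_id t : 1 <= t -> psi t = t.
Proof. by move=> t1; rewrite /psi /spline !ger0_relu; [field|lra..]. Qed.

Lemma dpsi_homo : {homo dpsi : x y / x <= y}.
Proof. exact: derive_ge0_homo is_derive_dpsi ddpsi_ge0. Qed.

Lemma dpsi_ge0 t : 0 <= dpsi t.
Proof.
have [t1|t1] := leP t (-1).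
  rewrite /dpsi /spline !ler0_relu; [|lra..].
  by rewrite !expr0n/=; lra.
rewrite (le_trans _ (dpsi_homo (ltW t1)))//.
by rewrite /dpsi /spline !ler0_relu ?expr0n/=; lra.
Qed.

Lemma dpsi_le1 t : dpsi t <= 1.
Proof.
have d1 s : 1 <= s -> dpsi s = 1.
  by move=> s1; rewrite /dpsi /spline !ger0_relu; [field|lra..].
have [t1|/ltW t1] := leP 1 t; first by rewrite d1.
by rewrite (le_trans (dpsi_homo t1))// d1.
Qed.

Lemma psi_homo : {homo psi : x y / x <= y}.
Proof. exact: derive_ge0_homo is_derive_psi dpsi_ge0. Qed.

Lemma psi_tangent x y : psi x + dpsi x * (y - x) <= psi y.
Proof. exact: tangent_le is_derive_psi dpsi_homo x y. Qed.

Lemma psi_convex (x y s : R) : 0 <= s -> s <= 1 ->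
  psi (s * x + (1 - s) * y) <= s * psi x + (1 - s) * psi y.
Proof.
(* Averaging the tangent inequalities at [z] cancels the slope, since [z] is the weighted mean of
   [x] and [y]. *)
move=> s0 s1; set z := s * x + (1 - s) * y.
have := psi_tangent z x; have := psi_tangent z y.
move: (dpsi z) (psi z) (psi x) (psi y) => d pz px py.
move=> /(ler_wpM2l (x := 1 - s)); rewrite subr_ge0 => /(_ s1).
move=> + /(ler_wpM2l s0) => H1 H2; have := lerD H1 H2; rewrite /z; lra.
Qed.

Lemma psi_lip x y : `|psi x - psi y| <= `|x - y|.
Proof.
rewrite -[leRHS]mul1r; apply: (derive_lipschitz is_derive_psi) => t.
by rewrite ger0_norm ?dpsi_ge0 ?dpsi_le1.
Qed.

Lemma dpsi_lip x y : `|dpsi x - dpsi y| <= `|x - y|.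
Proof.
rewrite -[leRHS]mul1r; apply: (derive_lipschitz is_derive_dpsi) => t.
by rewrite ger0_norm ?ddpsi_ge0 ?ddpsi_le1.
Qed.

Lemma psi_ge0 t : 0 <= psi t.
Proof.
have [t1|/ltW t1] := leP t (-1); first by rewrite psi_eq0.
by rewrite -(@psi_eq0 (-1))// psi_homo.
Qed.

(** The tangent line of [psi] at [1] is the identity. *)
Lemma psi_ge t : t <= psi t.
Proof.
have := psi_tangent 1 t; rewrite psi_id//.
by rewrite /dpsi /spline !ger0_relu; lra.
Qed.

Lemma psi0 : psi 0 = 6^-1.
Proof.
rewrite /psi /spline sub0r add0r ger0_relu// (ler0_relu (lexx 0)).
by rewrite ler0_relu// !expr0n expr1n/=; field.
Qed.

Lemma psi_le t : psi t <= `|t| + 1.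
Proof.
have := psi_lip t 0; rewrite psi0 subr0; have := ler_norm (psi t - 6^-1); lra.
Qed.

Lemma psi_le0 t : t <= 0 -> psi t <= 6^-1.
Proof. by move=> t0; rewrite -psi0 psi_homo. Qed.

Lemma psi_continuous : continuous psi.
Proof.
move=> t; have [d _] := is_derive_psi t.
exact/differentiable_continuous/derivable1_diffP.
Qed.

End SmoothedPositivePart.

(** * Nested folds *)

Section Fold.
Context {R : realType}.
Implicit Types (X Y : R) (b : bool) (th pre rest : seq bool).

Definition sg b : R := if b then 1 else -1.

(** Coordinates that map the child sector, of axis [X = sg b * Y / 2] and a quarter of the width,
    back onto the parent sector [|X| <= Y]. *)
Definition zoom b X Y : R := 4 * (X - sg b * Y / 2).

(* Constants are chosen so that [fold th X Y = `|X| - 14/19 Y] for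
   [`|Y| + 1 <= `|X|], whatever [th] (see [fold_far]). *)
Fixpoint fold th X Y : R :=
  if th is b :: th' then
    4 / 5 * (psi (- Y - sg b * X) + psi (sg b * X - 3 / 4 * Y))
      + fold th' (zoom b X Y) Y / 20
  else psi (X - 14 / 19 * Y) + psi (- X - 14 / 19 * Y).

(* [zoom] iterated along [th] is [4 ^+ size th * (X - axis th * Y)]. *)
Fixpoint axis th : R :=
  if th is b :: th' then sg b / 2 + axis th' / 4 else 0.

Definition offset th X Y : R := 4 ^+ size th * `|X - axis th * Y|.

Lemma offset_cons b th X Y : offset (b :: th) X Y = offset th (zoom b X Y) Y.
Proof.
rewrite /offset/= exprSr -mulrA; congr (_ * _).
rewrite -[X in X * _](@ger0_norm _ 4)// -normrM; congr `|_|.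
by rewrite /zoom; field.
Qed.

(** The bound is the fixed point of [x = 1 / 2 + x / 4]. *)
Lemma axis_bound th : `|axis th| <= 2 / 3.
Proof.
elim: th => [|b th IH] /=; first by rewrite normr0; lra.
by move: IH; rewrite !ler_norml /sg; case: b; lra.
Qed.

Lemma fold_convex th (X Y X' Y' s : R) : 0 <= s -> s <= 1 ->
  fold th (s * X + (1 - s) * X') (s * Y + (1 - s) * Y') <=
    s * fold th X Y + (1 - s) * fold th X' Y'.
Proof.
move=> s0 s1; elim: th X X' => [|b th IH] X X' /=.
  have := psi_convex (X - 14 / 19 * Y) (X' - 14 / 19 * Y') s0 s1.
  have := psi_convex (- X - 14 / 19 * Y) (- X' - 14 / 19 * Y') s0 s1.
  have -> : s * (X - 14 / 19 * Y) + (1 - s) * (X' - 14 / 19 * Y') =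
    s * X + (1 - s) * X' - 14 / 19 * (s * Y + (1 - s) * Y') by ring.
  have -> : s * (- X - 14 / 19 * Y) + (1 - s) * (- X' - 14 / 19 * Y') =
    - (s * X + (1 - s) * X') - 14 / 19 * (s * Y + (1 - s) * Y') by ring.
  lra.
have := IH (zoom b X Y) (zoom b X' Y').
have -> : s * zoom b X Y + (1 - s) * zoom b X' Y' =
  zoom b (s * X + (1 - s) * X') (s * Y + (1 - s) * Y') by rewrite /zoom; field.
have := psi_convex (- Y - sg b * X) (- Y' - sg b * X') s0 s1.
have := psi_convex (sg b * X - 3 / 4 * Y) (sg b * X' - 3 / 4 * Y') s0 s1.
have -> : s * (- Y - sg b * X) + (1 - s) * (- Y' - sg b * X') =
  - (s * Y + (1 - s) * Y') - sg b * (s * X + (1 - s) * X') by ring.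
have -> : s * (sg b * X - 3 / 4 * Y) + (1 - s) * (sg b * X' - 3 / 4 * Y') =
  sg b * (s * X + (1 - s) * X') - 3 / 4 * (s * Y + (1 - s) * Y') by field.
lra.
Qed.

Lemma normrM_sg b X : `|sg b * X| = `|X|.
Proof. by rewrite /sg; case: b; rewrite ?mul1r// mulN1r normrN. Qed.

(** A child is stretched by at most 4 but weighted by 1 / 20, so the growth does not depend on the
    depth. On the square [|X|, |Y| <= 5 / 4] the bound is 7, which the shift by 8 in [valley] brings
    down to -1, where [psi] vanishes. *)
Lemma fold_le th X Y : fold th X Y <= 2 * `|X| + 2 * `|Y| + 2.
Proof.
elim: th X => [|b th IH] X /=.
  have := psi_le (X - 14 / 19 * Y); have := psi_le (- X - 14 / 19 * Y).
  have [/= h1 h2] : (`|X - 14 / 19 * Y| <= `|X| + 14 / 19 * `|Y|) /\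
     (`|- X - 14 / 19 * Y| <= `|X| + 14 / 19 * `|Y|).
    by case: (ger0P X); case: (ger0P Y) => ? ?; rewrite !ler_norml; lra.
  by have := normr_ge0 Y; lra.
have := IH (zoom b X Y).
have := psi_le (- Y - sg b * X); have := psi_le (sg b * X - 3 / 4 * Y).
have : `|- Y - sg b * X| <= `|X| + `|Y|.
  by rewrite -opprD normrN (le_trans (ler_normD _ _))// normrM_sg addrC.
have : `|sg b * X - 3 / 4 * Y| <= `|X| + 3 / 4 * `|Y|.
  by rewrite (le_trans (ler_normB _ _))// normrM_sg normrM (ger0_norm (_ : 0 <= 3 / 4)).
have : `|zoom b X Y| <= 4 * `|X| + 2 * `|Y|.
  rewrite /zoom normrM ger0_norm// -(mulrA (sg b)).
  have := ler_normB X (sg b * (Y / 2)).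
  by rewrite normrM_sg normrM (ger0_norm (_ : 0 <= 2^-1))//; lra.
have := normr_ge0 X; have := normr_ge0 Y; lra.
Qed.

Lemma zoom_far b X Y : `|Y| + 1 <= `|X| -> `|Y| + 1 <= `|zoom b X Y|.
Proof.
rewrite /zoom /sg; case: b; case: (ger0P X); case: (ger0P Y) => ? ? ?;
  case: ger0P; lra.
Qed.

(** A point far from a sector is far from its child, and the two levels add up: the slopes give
    [4 / 5 + 4 / 20 = 1], and 14 / 19 is the fixed point of [c = 7 / 10 + c / 20]. *)
Lemma fold_far th X Y : `|Y| + 1 <= `|X| -> fold th X Y = `|X| - 14 / 19 * Y.
Proof.
elim: th X => [|b th IH] X XY /=.
  have [Y0|Y0] := ger0P Y; have [X0|X0] := ger0P X.
  all: rewrite ?(ger0_norm X0) ?(ltr0_norm X0) ?(ger0_norm Y0) ?(ltr0_norm Y0) in XY *.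
  - by rewrite (@psi_id _ (X - _)) ?psi_eq0; lra.
  - by rewrite (@psi_id _ (- X - _)) ?psi_eq0; lra.
  - by rewrite (@psi_id _ (X - _)) ?psi_eq0; lra.
  - by rewrite (@psi_id _ (- X - _)) ?psi_eq0; lra.
rewrite IH; last exact: zoom_far.
rewrite /zoom /sg; case: b; rewrite ?mul1r ?mulN1r;
  have [Y0|Y0] := ger0P Y; have [X0|X0] := ger0P X.
all: rewrite ?(ger0_norm X0) ?(ltr0_norm X0) ?(ger0_norm Y0) ?(ltr0_norm Y0) in XY.
- by rewrite (@psi_eq0 _ (- Y - _)) ?(@psi_id _ (X - _)) ?ger0_norm; lra.
- by rewrite (@psi_eq0 _ (X - _)) ?(@psi_id _ (- Y - _)) ?ltr0_norm; lra.
- by rewrite (@psi_eq0 _ (- Y - _)) ?(@psi_id _ (X - _)) ?ger0_norm; lra.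
- by rewrite (@psi_eq0 _ (X - _)) ?(@psi_id _ (- Y - _)) ?ltr0_norm; lra.
- by rewrite (@psi_eq0 _ (- X - _)) ?(@psi_id _ (- Y - _)) ?ger0_norm; lra.
- by rewrite (@psi_eq0 _ (- Y - _)) ?(@psi_id _ (- X - _)) ?ltr0_norm; lra.
- by rewrite (@psi_eq0 _ (- X - _)) ?(@psi_id _ (- Y - _)) ?ger0_norm; lra.
- by rewrite (@psi_eq0 _ (- Y - _)) ?(@psi_id _ (- X - _)) ?ltr0_norm; lra.
Qed.

(** Every ridge is nonnegative, so only the innermost pair is kept; it carries the accumulated
    weight [20 ^- size th]. *)
Lemma fold_ge th X Y : (offset th X Y - `|Y|) / 20 ^+ size th <= fold th X Y.
Proof.
elim: th X => [|b th IH] X.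
  rewrite /offset expr0 mul1r divr1 mul0r subr0/=.
  have := psi_ge (X - 14 / 19 * Y); have := psi_ge (- X - 14 / 19 * Y).
  have := psi_ge0 (X - 14 / 19 * Y); have := psi_ge0 (- X - 14 / 19 * Y).
  by case: (ger0P X); case: (ger0P Y) => ? ?; lra.
rewrite offset_cons [size _]/= exprS invfM mulrCA [fold _ _ _]/=.
have := psi_ge0 (- Y - sg b * X); have := psi_ge0 (sg b * X - 3 / 4 * Y).
by have := IH (zoom b X Y); lra.
Qed.

(** The second conclusion drives the induction: [|zoom b X Y| <= Y] places [sg b * X] between
    [Y / 4] and [3 / 4 * Y], where both ridges of the level have a nonpositive argument and
    contribute at most [psi 0 = 1 / 6] each. *)
Lemma fold_le1 th X Y : offset th X Y <= Y / 2 -> fold th X Y <= 1 /\ `|X| <= Y.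
Proof.
elim: th X => [|b th IH] X.
  rewrite /offset expr0 mul1r mul0r subr0/= => XY; have := normr_ge0 X.
  have := ler_norm X; have := ler_norm (- X); rewrite normrN => ? ? ?.
  split; last lra.
  have := @psi_le0 _ (X - 14 / 19 * Y); have := @psi_le0 _ (- X - 14 / 19 * Y).
  lra.
rewrite offset_cons => /IH[f1 +]; rewrite [fold _ _ _]/=.
rewrite {1}/zoom ler_norml => /andP[XY XY'].
have := @psi_le0 _ (- Y - sg b * X); have := @psi_le0 _ (sg b * X - 3 / 4 * Y).
by move: f1 XY XY'; rewrite ler_norml /sg; case: b => ? ? ? ? ?; lra.
Qed.

(* Nothing of the digits beyond [rcons pre b] can be seen at [(X, Y)]. *)
Fixpoint blind pre b X Y : Prop :=
  if pre is e :: pre' then blind pre' b (zoom e X Y) Y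
  else `|Y| + 1 < `|zoom b X Y|.

(** By [fold_far] the innermost visible fold takes a value in which its digits no longer occur. *)
Lemma blind_eq pre b rest rest' X Y : blind pre b X Y ->
  fold (pre ++ b :: rest) X Y = fold (pre ++ b :: rest') X Y.
Proof.
elim: pre X => [|e pre IH] X /=; last by move=> /IH ->.
by move=> /ltW XY; rewrite !fold_far.
Qed.

(* Two children that are both visible force [(X, Y)] to be close to the apex. *)
Lemma blind_or_core pre X Y :
  (`|X| <= 1 /\ `|Y| <= 1) \/ exists b, blind pre b X Y.
Proof.
elim: pre X => [|e pre IH] X /=; last first.
  have [[X1 Y1]|[b H]] := IH (zoom e X Y); [left; split => //|by right; exists b].
  move: X1 Y1; rewrite /zoom /sg !ler_norml.
  by case: e => /andP[? ?] /andP[? ?]; apply/andP; split; lra.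
have [H|+] := ltP (`|Y| + 1) `|zoom true X Y|; first by right; exists true.
have [H|+] := ltP (`|Y| + 1) `|zoom false X Y|; first by right; exists false.
rewrite /zoom /sg !(ler_norml (4 * _)) => H H'; left; move: H H'.
by case: (ger0P Y) => ?; case: (ger0P X) => ? /andP[? ?] /andP[? ?]; lra.
Qed.

(** Blindness is a strict inequality between continuous functions, hence open. This carries the
    agreement of two potentials from a point to a neighbourhood, and so to their gradients. *)
Lemma blind_near (T : topologicalType) (p : T) (f1 f2 : T -> R) pre b :
  {for p, continuous f1} -> {for p, continuous f2} ->
  blind pre b (f1 p) (f2 p) -> \forall q \near p, blind pre b (f1 q) (f2 q).
Proof.
have cz e g1 g2 : {for p, continuous g1} -> {for p, continuous g2} ->
    {for p, continuous (fun q => zoom e (g1 q) (g2 q))}.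
  move=> c1 c2; rewrite /zoom; apply: cvgM; first exact: cvg_cst.
  apply: cvgB; first exact: c1.
  by apply: cvgM; [apply: cvgM; [exact: cvg_cst|exact: c2]|exact: cvg_cst].
move=> + c2; elim: pre f1 => [|e pre IH] f1 c1 /=; last first.
  by move=> H; apply: (IH (fun q => zoom e (f1 q) (f2 q))) => //; exact: cz.
rewrite -subr_gt0 => H.
have c : {for p, continuous
    (fun q => `|zoom b (f1 q) (f2 q)| - (`|f2 q| + 1))}.
  apply: cvgB; first by apply: cvg_norm; exact: cz.
  by apply: cvgD; [exact: cvg_norm|exact: cvg_cst].
near=> q; rewrite -subr_gt0; near: q.
exact: (cvgr_gt _ c).
Unshelve. all: by end_near. Qed.

(** Where the digits first differ, the remaining digits cannot close the gap: it is at least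
    [1 - 2 * (2 / 3) / 4 = 2 / 3]. Each common digit before it divides the gap by 4. *)
Lemma axis_separated th th' : size th = size th' -> th != th' ->
  2 <= 4 ^+ size th * `|axis th - axis th'|.
Proof.
elim: th th' => [|b th IH] [|b' th'] //= [sth].
have [<-|bb'] := eqVneq b b'.
  rewrite eqseq_cons eqxx/= => /(IH _ sth).
  set x := axis th; set y := axis th'.
  have -> : sg b / 2 + x / 4 - (sg b / 2 + y / 4) = (x - y) / 4 by field.
  rewrite normrM (ger0_norm (_ : 0 <= 4^-1))// exprS => H.
  by rewrite (_ : _ * _ = 4 ^+ size th * `|x - y|)//; field.
move=> _; have := axis_bound th; have := axis_bound th'.
have : 1 <= 4 ^+ size th :> R by rewrite exprn_ege1// ler1n.
move: (axis th) (axis th') => x y.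
rewrite exprS !ler_norml => h1 /andP[h2 h3] /andP[h4 h5].
suff : 2 / 3 <= `|sg b / 2 + x / 4 - (sg b' / 2 + y / 4)|.
  by move: (`| _ |) => z; nra.
by rewrite /sg; case: b b' bb' => -[] // _; case: ger0P; lra.
Qed.

End Fold.

(** * Gradients and their Lipschitz bounds *)

Section Gradients.
Context {R : realType}.
Implicit Types (f g : R * R -> R) (p q : R * R).

(** Total differentiability is used because, unlike the existence of partial derivatives, it obeys
    the chain rule; [has_grad_derive] recovers [d1] and [d2]. *)
Definition has_grad f f1 f2 := forall p,
  is_diff p f (fun v : R * R => v.1 * f1 p + v.2 * f2 p).

Definition cont_grad f :=
  exists f1 f2, [/\ has_grad f f1 f2, continuous f1 & continuous f2].

Lemma has_grad_derive f f1 f2 : has_grad f f1 f2 ->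
  [/\ forall p, derivable f p ((1, 0) : R * R),
      forall p, derivable f p ((0, 1) : R * R), d1 f = f1 & d2 f = f2].
Proof.
move=> gf; split.
- by move=> p; apply: diff_derivable; have [] := gf p.
- by move=> p; apply: diff_derivable; have [] := gf p.
- apply/funext => p; have [df dfE] := gf p.
  by rewrite /d1 deriveE// dfE/= mul1r mul0r addr0.
- apply/funext => p; have [df dfE] := gf p.
  by rewrite /d2 deriveE// dfE/= mul1r mul0r add0r.
Qed.

Lemma cont_grad_C1 f : cont_grad f -> C1 f.
Proof.
move=> [f1 [f2 [/has_grad_derive[h1 h2 e1 e2] c1 c2]]].
split; [exact: h1|exact: h2|rewrite e1; exact: c1|rewrite e2; exact: c2].
Qed.

Lemma has_grad_continuous f f1 f2 : has_grad f f1 f2 -> continuous f.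
Proof. by move=> gf p; apply: differentiable_continuous; have [] := gf p. Qed.

Lemma cont_grad_continuous f : cont_grad f -> continuous f.
Proof. by move=> [f1 [f2 [/has_grad_continuous]]]. Qed.

Lemma has_grad_cst (c : R) : has_grad (fun=> c) (fun=> 0) (fun=> 0).
Proof.
move=> p; apply: (is_diff_eq (is_diff_cst c p)).
by apply/funext => v /=; rewrite !mulr0 addr0.
Qed.

Lemma has_grad_lin (a b : R) :
  has_grad (fun p => a * p.1 + b * p.2) (fun=> a) (fun=> b).
Proof.
move=> p.
have cfst : continuous (fst : R * R -> R) by move=> q; exact: cvg_fst.
have csnd : continuous (snd : R * R -> R) by move=> q; exact: cvg_snd.
have d1 : is_diff p (fst : R * R -> R) fst.
  pose F : {linear (R^o * R^o)%type -> R^o} := fst.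
  by split; [exact: (@linear_differentiable _ _ _ F)|exact: (@diff_lin _ _ _ F)].
have d2 : is_diff p (snd : R * R -> R) snd.
  pose F : {linear (R^o * R^o)%type -> R^o} := snd.
  by split; [exact: (@linear_differentiable _ _ _ F)|exact: (@diff_lin _ _ _ F)].
apply: (is_diff_eq (is_diffD (is_diffZ a d1) (is_diffZ b d2))).
by apply/funext => v; rewrite !fctE /GRing.scale/=; ring.
Qed.

Lemma has_gradD f f1 f2 g g1 g2 : has_grad f f1 f2 -> has_grad g g1 g2 ->
  has_grad (fun p => f p + g p) (fun p => f1 p + g1 p) (fun p => f2 p + g2 p).
Proof.
move=> gf gg p; apply: (is_diff_eq (is_diffD (gf p) (gg p))).
by apply/funext => v /=; rewrite fctE; ring.
Qed.

Lemma has_gradM f f1 f2 g g1 g2 : has_grad f f1 f2 -> has_grad g g1 g2 ->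
  has_grad (fun p => f p * g p) (fun p => f1 p * g p + f p * g1 p)
    (fun p => f2 p * g p + f p * g2 p).
Proof.
move=> gf gg p; apply: (is_diff_eq (is_diffM (gf p) (gg p))).
apply/funext => v; rewrite !fctE/= /GRing.scale/=. ring.
Qed.

Lemma has_grad_comp (h dh : R -> R) f f1 f2 :
  (forall t : R, is_derive t 1 h (dh t)) -> has_grad f f1 f2 ->
  has_grad (fun p => h (f p)) (fun p => dh (f p) * f1 p)
    (fun p => dh (f p) * f2 p).
Proof.
move=> hdh gf p.
have dhp : is_diff (f p) h (fun t => t * dh (f p)).
  have [dh1 dh2] := hdh (f p).
  split; first exact/derivable1_diffP.
  by rewrite deriv1E// derive1E dh2.
apply: (is_diff_eq (is_diff_comp (gf p) dhp)).
by apply/funext => v /=; ring.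
Qed.

Lemma cont_grad_cst (c : R) : cont_grad (fun=> c).
Proof.
by exists (fun=> 0), (fun=> 0); split;
  [exact: has_grad_cst|exact: cst_continuous..].
Qed.

Lemma cont_gradD f g : cont_grad f -> cont_grad g ->
  cont_grad (fun p => f p + g p).
Proof.
move=> [f1 [f2 [gf cf1 cf2]]] [g1 [g2 [gg cg1 cg2]]].
exists (fun p => f1 p + g1 p), (fun p => f2 p + g2 p).
split; first exact: has_gradD.
- by move=> p; apply: cvgD; [exact: cf1|exact: cg1].
- by move=> p; apply: cvgD; [exact: cf2|exact: cg2].
Qed.

Lemma cont_gradM f g : cont_grad f -> cont_grad g ->
  cont_grad (fun p => f p * g p).
Proof.
move=> cf cg; have := cont_grad_continuous cf; have := cont_grad_continuous cg.
move: cf cg => [f1 [f2 [gf cf1 cf2]]] [g1 [g2 [gg cg1 cg2]]] cg cf.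
exists (fun p => f1 p * g p + f p * g1 p), (fun p => f2 p * g p + f p * g2 p).
split; first exact: has_gradM.
- move=> p; apply: cvgD; apply: cvgM;
    [exact: cf1|exact: cg|exact: cf|exact: cg1].
- move=> p; apply: cvgD; apply: cvgM;
    [exact: cf2|exact: cg|exact: cf|exact: cg2].
Qed.

Lemma cont_grad_comp (h dh : R -> R) f :
  (forall t : R, is_derive t 1 h (dh t)) -> continuous dh ->
  cont_grad f -> cont_grad (fun p => h (f p)).
Proof.
move=> hdh cdh cf; have := cont_grad_continuous cf.
move: cf => [f1 [f2 [gf cf1 cf2]]] cf.
exists (fun p => dh (f p) * f1 p), (fun p => dh (f p) * f2 p).
have c p : {for p, continuous (fun p => dh (f p))}.
  by apply: continuous_comp; [exact: cf|exact: cdh].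
split; first exact: has_grad_comp.
- by move=> p; apply: cvgM; [exact: c|exact: cf1].
- by move=> p; apply: cvgM; [exact: c|exact: cf2].
Qed.

Definition dist1 p q : R := `|p.1 - q.1| + `|p.2 - q.2|.

Lemma dist1_ge0 p q : 0 <= dist1 p q. Proof. exact: addr_ge0. Qed.

Definition lip (k : R) f := forall p q, `|f p - f q| <= k * dist1 p q.

(** First-order bounds [k] and second-order bounds [l], in the form that survives composition with
    [psi]. Carrying [lip k f] along avoids a mean value theorem in the plane. *)
Definition regular (k l : R) f := exists f1 f2,
  [/\ has_grad f f1 f2, cont_grad f1 /\ cont_grad f2, lip k f,
      (forall p, `|f1 p| <= k) /\ (forall p, `|f2 p| <= k) & lip l f1 /\ lip l f2].

Lemma regular_le k k' l l' f : k <= k' -> l <= l' ->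
  regular k l f -> regular k' l' f.
Proof.
move=> kk' ll' [f1 [f2 [gf cf lf [b1 b2] [l1 l2]]]]; exists f1, f2; split => //.
- by move=> p q; rewrite (le_trans (lf p q))// ler_wpM2r// dist1_ge0.
- by split => p; rewrite (le_trans _ kk').
- by split => p q; [rewrite (le_trans (l1 p q))//|rewrite (le_trans (l2 p q))//];
    rewrite ler_wpM2r// dist1_ge0.
Qed.

Lemma lin_lip (a b k : R) : `|a| <= k -> `|b| <= k ->
  lip k (fun p => a * p.1 + b * p.2).
Proof.
move=> ak bk p q.
rewrite (_ : _ - _ = a * (p.1 - q.1) + b * (p.2 - q.2)); last by ring.
rewrite (le_trans (ler_normD _ _))// !normrM mulrDr.
by apply: lerD; rewrite ler_wpM2r.
Qed.

Lemma regular_lin (a b k : R) : `|a| <= k -> `|b| <= k ->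
  regular k 0 (fun p => a * p.1 + b * p.2).
Proof.
move=> ak bk; exists (fun=> a), (fun=> b); split => //.
- exact: has_grad_lin.
- by split; exact: cont_grad_cst.
- exact: lin_lip.
- by split => p q; rewrite subrr normr0 mul0r.
Qed.

Lemma regularD k l f k' l' g : regular k l f -> regular k' l' g ->
  regular (k + k') (l + l') (fun p => f p + g p).
Proof.
have lD c c' u v : lip c u -> lip c' v -> lip (c + c') (fun p => u p + v p).
  move=> lu lv p q; rewrite opprD addrACA (le_trans (ler_normD _ _))//.
  by rewrite mulrDl lerD.
move=> [f1 [f2 [gf [cf1 cf2] lf [b1 b2] [l1 l2]]]].
move=> [g1 [g2 [gg [cg1 cg2] lg [b1' b2'] [l1' l2']]]].
exists (fun p => f1 p + g1 p), (fun p => f2 p + g2 p); split.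
- exact: has_gradD.
- by split; exact: cont_gradD.
- exact: lD.
- by split => p; rewrite (le_trans (ler_normD _ _))// lerD.
- by split; exact: lD.
Qed.

Lemma regularZ c k l f : 0 <= c -> regular k l f ->
  regular (c * k) (c * l) (fun p => c * f p).
Proof.
have lZ u j : 0 <= c -> lip j u -> lip (c * j) (fun p => c * u p).
  move=> c0 lu p q; rewrite -mulrBr normrM ger0_norm// -mulrA.
  by rewrite ler_wpM2l.
move=> c0 [f1 [f2 [gf [cf1 cf2] lf [b1 b2] [l1 l2]]]].
exists (fun p => c * f1 p), (fun p => c * f2 p); split.
- move=> p; have := has_gradM (has_grad_cst c) gf p.
  by move=> /is_diff_eq; apply; apply/funext => v /=; ring.
- by split; apply: cont_gradM => //; exact: cont_grad_cst.
- exact: lZ.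
- by split => p; rewrite normrM ger0_norm// ler_wpM2l.
- by split; exact: lZ.
Qed.

Lemma regularDcst k l f (c : R) : regular k l f -> regular k l (fun p => f p + c).
Proof.
move=> [f1 [f2 [gf cf lf b l12]]]; exists f1, f2; split => //.
- move=> p; have := has_gradD gf (has_grad_cst c) p.
  by move=> /is_diff_eq; apply; apply/funext => v /=; rewrite !addr0.
- by move=> p q; rewrite opprD addrACA subrr addr0.
Qed.

(** In the derivative [dpsi f * f1], the variation of the first factor costs [k * k] and that of the
    second costs [l], as [dpsi] is 1-Lipschitz with values in [0, 1]. *)
Lemma regular_psi k l f : 0 <= k -> regular k l f ->
  regular k (k ^+ 2 + l) (fun p => psi (f p)).
Proof.
move=> k0 [f1 [f2 [gf [cf1 cf2] lf [b1 b2] [l1 l2]]]].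
have cf : cont_grad f.
  by exists f1, f2; split => //; exact: cont_grad_continuous.
have bM u : (forall p, `|u p| <= k) -> forall p, `|dpsi (f p) * u p| <= k.
  move=> ku p; rewrite normrM (le_trans _ (ku p))// ler_piMl//.
  by rewrite ger0_norm ?dpsi_ge0 ?dpsi_le1.
have lM u : (forall p, `|u p| <= k) -> lip l u ->
    lip (k ^+ 2 + l) (fun p => dpsi (f p) * u p).
  move=> ku lu p q.
  rewrite (_ : _ - _ = (dpsi (f p) - dpsi (f q)) * u p
    + dpsi (f q) * (u p - u q)); last by ring.
  rewrite (le_trans (ler_normD _ _))// [leRHS]mulrDl lerD// normrM.
    rewrite expr2 mulrAC ler_pM//.
    exact: le_trans (dpsi_lip _ _) (lf p q).
  rewrite (le_trans _ (lu p q))// ler_piMl//.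
  by rewrite ger0_norm ?dpsi_ge0 ?dpsi_le1.
have cd : cont_grad (fun p => dpsi (f p)).
  exact: cont_grad_comp is_derive_dpsi ddpsi_continuous cf.
exists (fun p => dpsi (f p) * f1 p), (fun p => dpsi (f p) * f2 p); split.
- exact: has_grad_comp is_derive_psi gf.
- by split; exact: cont_gradM.
- by move=> p q; exact: le_trans (psi_lip _ _) (lf p q).
- by split; exact: bM.
- by split; exact: lM.
Qed.

Lemma regular_psi_lin (a b k : R) : `|a| <= k -> `|b| <= k ->
  regular k (k ^+ 2) (fun p => psi (a * p.1 + b * p.2)).
Proof.
move=> ak bk; rewrite -[k ^+ 2]addr0; apply: regular_psi.
  exact: le_trans ak.
exact: regular_lin.
Qed.

(** The bounds do not depend on the depth: [zoom] multiplies [k] by 4, hence [k ^+ 2] by 16, and the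
    weight 1 / 20 more than compensates. The second-order constants close since
    [8 / 5 + 16 * 10 / 20 <= 10]. *)
Lemma regular_fold th (a b c k : R) : `|a| <= k -> `|b| + `|c| <= k ->
  regular (5 / 2 * k) (10 * k ^+ 2)
    (fun p => fold th (a * p.1 + b * p.2) (c * p.2)).
Proof.
elim: th a b k => [|e th IH] a b k ak bck.
  have k0 : 0 <= k by exact: le_trans ak.
  have r1 : regular k (k ^+ 2) (fun p => psi (a * p.1 + (b - 14 / 19 * c) * p.2)).
    apply: regular_psi_lin => //.
    by move: bck; rewrite (ler_norml (b - _)); case: (ger0P b);
      case: (ger0P c) => ? ? ?; lra.
  have r2 : regular k (k ^+ 2) (fun p => psi (- a * p.1 + (- b - 14 / 19 * c) * p.2)).
    apply: regular_psi_lin; first by rewrite normrN.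
    by move: bck; rewrite (ler_norml (- b - _)); case: (ger0P b);
      case: (ger0P c) => ? ? ?; lra.
  have := regularD r1 r2.
  rewrite (_ : (fun p => _ + _) = (fun p => fold [::] (a * p.1 + b * p.2) (c * p.2)));
    last by apply/funext => p /=; congr (psi _ + psi _); ring.
  by apply: regular_le; nra.
have k0 : 0 <= k by exact: le_trans ak.
have r1 : regular k (k ^+ 2) (fun p => psi (- (sg e * a) * p.1 + (- c - sg e * b) * p.2)).
  apply: regular_psi_lin; first by rewrite normrN normrM_sg.
  by rewrite (le_trans (ler_normB _ _))// normrN normrM_sg addrC.
have r2 : regular k (k ^+ 2)
    (fun p => psi (sg e * a * p.1 + (sg e * b - 3 / 4 * c) * p.2)).
  apply: regular_psi_lin; first by rewrite normrM_sg.
  rewrite (le_trans (ler_normB _ _))// normrM_sg normrM (ger0_norm (_ : 0 <= 3 / 4))//.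
  by rewrite (le_trans _ bck)// lerD2l ler_piMl//; lra.
have r3 := @IH (4 * a) (4 * (b - sg e * (c / 2))) (4 * k).
have {}r3 := r3 _ _.
have h1 : `|4 * a| <= 4 * k by rewrite normrM ger0_norm// ler_wpM2l.
have h2 : `|4 * (b - sg e * (c / 2))| + `|c| <= 4 * k.
  rewrite normrM ger0_norm//.
  have := ler_normB b (sg e * (c / 2)).
  rewrite normrM_sg normrM (ger0_norm (_ : 0 <= 2^-1))//.
  have := normr_ge0 c; have := normr_ge0 b; lra.
have := regularD (regularZ (_ : 0 <= 4 / 5) (regularD r1 r2))
  (regularZ (_ : 0 <= 20^-1) (r3 h1 h2)).
rewrite (_ : (fun p => _ + _) = (fun p => fold (e :: th) (a * p.1 + b * p.2) (c * p.2)));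
  last first.
  apply/funext => p /=; congr (_ * (psi _ + psi _) + _); [ring|ring|].
  by rewrite mulrC; congr (fold _ _ _ / _); rewrite /zoom; field.
move=> /(_ _ _) H; apply: regular_le (H _ _) => //; nra.
Qed.

End Gradients.

(** * Counting identified words *)

Section Counting.

Fixpoint words d : seq (seq bool) :=
  if d is d'.+1 then
    [seq true :: s | s <- words d'] ++ [seq false :: s | s <- words d']
  else [:: [::]].

Lemma mem_words d (s : seq bool) : (s \in words d) = (size s == d).
Proof.
elim: d s => [|d IH] s /=; first by rewrite inE; case: s.
case: s => [|b s]; rewrite mem_cat; first by apply/orP => -[] /mapP[].
rewrite eqSS -IH; have inj (c : bool) : injective (cons c) by move=> ? ? [].
case: b; rewrite (mem_map (inj _)) ?orbF //=.
  by apply/orb_idr => /mapP[? _].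
by apply/orb_idl => /mapP[? _].
Qed.

Lemma words_uniq d : uniq (words d).
Proof.
elim: d => [//|d IH] /=; have inj (c : bool) : injective (cons c) by move=> ? ? [].
rewrite cat_uniq !(map_inj_uniq (inj _)) IH andbT /=.
by apply/hasPn => _ /mapP[s _ ->]; apply/mapP => -[].
Qed.

Lemma size_words d : size (words d) = (2 ^ d)%N.
Proof. by elim: d => //= d IH; rewrite size_cat !size_map IH addnn -mul2n expnS. Qed.

Lemma count_le1 (T : eqType) (a : pred T) (s : seq T) : uniq s ->
  {in s &, forall x y, a x -> a y -> x = y} -> (count a s <= 1)%N.
Proof.
elim: s => //= x s IH /andP[xs us] H.
case ax : (a x) => /=.
  rewrite (_ : count a s = 0%N)//; apply/eqP; rewrite -leqn0 leqNgt -has_count.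
  apply/hasPn => y ys; apply/negP => ay.
  have xy : x = y by apply: H => //; rewrite ?mem_head// inE ys orbT.
  by move: xs; rewrite xy ys.
by apply: IH => // y z ys zs; apply: H; rewrite inE (ys, zs) orbT.
Qed.

Context {R : realType} {Omega : Type}.
Variables (alg : query_algorithm R Omega) (w : Omega).
Variables (V : seq bool -> R * R -> R) (hit : seq bool -> pred (R * R)).
Hypothesis hit_inj : forall s t z, size s = size t -> hit s z -> hit t z -> s = t.
Hypothesis one_blind_child : forall pre d p, exists b, forall s t,
  size s = d -> size t = d ->
  oracle (V (pre ++ b :: s)) p = oracle (V (pre ++ b :: t)) p.

(** The transcript [h] is arbitrary and common to all completions of [pre]; it need not be
    consistent with their potentials. *)
Let hits n h d pre := count (fun s =>
  hit (pre ++ s) (output alg w (interact alg (V (pre ++ s)) w n h))) (words d).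

(** Once the querying stops, all completions share one output point, and by [hit_inj] it hits at
    most one of them. *)
Let hits_stop d pre z : (count (fun s => hit (pre ++ s) z) (words d) * 2 ^ d
  <= 3 ^ d)%N.
Proof.
rewrite -[leqRHS]mul1n leq_mul//; last by case: d => // d; rewrite leq_exp2r.
apply: count_le1; first exact: words_uniq.
move=> s t; rewrite !mem_words => /eqP sd /eqP td hs ht.
have e : size (pre ++ s) = size (pre ++ t) by rewrite !size_cat sd td.
by have /eqP := hit_inj e hs ht; rewrite eqseq_cat// eqxx => /eqP.
Qed.

(** Induction on the queries, then on the depth. A query costs one unit on the blind child, whose
    completions all receive the same answer, and is still pending on the other child. The recurrence
    [T (n + 1) (d + 1) <= T n d + T (n + 1) d] is solved by [2 ^ n (3 / 2) ^ d]; the factor [2 ^ d]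
    clears denominators. *)
Lemma count_hits n h d pre : (hits n h d pre * 2 ^ d <= 2 ^ n * 3 ^ d)%N.
Proof.
elim: n h d pre => [|n IHn] h d pre.
  by rewrite mul1n; exact: (hits_stop d pre (output alg w h)).
rewrite /hits /=; case qE: (next_query alg w h) => [x|]; last first.
  rewrite (leq_trans (hits_stop _ _ _))// -[leqLHS]mul1n leq_mul//.
  by rewrite expn_gt0.
elim: d pre => [|d IHd] pre.
  rewrite !muln1 (leq_trans (count_size _ _))//= expn_gt0//.
have [b Hb] := one_blind_child pre d x.
have HI : (count (fun s => hit (pre ++ b :: s) (output alg w (interact alg
    (V (pre ++ b :: s)) w n (rcons h (x, oracle (V (pre ++ b :: s)) x))))) (words d)
    * 2 ^ d <= 2 ^ n * 3 ^ d)%N.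
  (* The answer common to all completions of the blind child; the word of [true] bits is an
     arbitrary representative. *)
  pose r := oracle (V (pre ++ b :: nseq d true)) x.
  apply: leq_trans (IHn (rcons h (x, r)) d (rcons pre b)).
  apply: leq_mul => //; apply/eq_leq/eq_in_count.
  move=> s; rewrite mem_words => /eqP sd /=.
  by rewrite cat_rcons (Hb _ (nseq d true))// size_nseq.
have HJ : (count (fun s => hit (pre ++ ~~ b :: s) (output alg w (interact alg
    (V (pre ++ ~~ b :: s)) w n (rcons h (x, oracle (V (pre ++ ~~ b :: s)) x)))))
    (words d) * 2 ^ d <= 2 ^ n.+1 * 3 ^ d)%N.
  apply: leq_trans (IHd (rcons pre (~~ b))).
  by apply: leq_mul => //; apply/eq_leq/eq_count => s; rewrite cat_rcons.
rewrite /= count_cat !count_map.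
set c1 := count _ _; set c2 := count _ _.
have -> : (c1 + c2 = count (fun s => hit (pre ++ b :: s) (output alg w (interact alg
    (V (pre ++ b :: s)) w n (rcons h (x, oracle (V (pre ++ b :: s)) x))))) (words d)
  + count (fun s => hit (pre ++ ~~ b :: s) (output alg w (interact alg
    (V (pre ++ ~~ b :: s)) w n (rcons h (x, oracle (V (pre ++ ~~ b :: s)) x)))))
    (words d))%N.
  by case: b {Hb HI HJ}; [reflexivity|exact: addnC].
move: HI HJ; rewrite !expnS; move: (count _ _) (count _ _) (2 ^ d)%N (2 ^ n)%N (3 ^ d)%N.
clear; move=> a b x y z; nia.
Qed.

End Counting.

(** * Mass of the valleys *)

Section Valley.
Context {R : realType}.
Implicit Types (th : seq bool) (p : R * R) (x y : R).

(* The dilation compensates the factor [20 ^- size th] of the deepest ridges of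
   [fold th], which thus get slope [4 ^+ size th]; the outer [psi] flattens the
   apex, where several sectors could be seen at once. *)
Definition valley th p : R :=
  (p.1 ^+ 2 + p.2 ^+ 2) / 2
    + psi (fold th (20 ^+ size th * p.1) (20 ^+ size th * p.2) - 8).

Lemma offset_scale th (c x y : R) : 0 <= c ->
  offset th (c * x) (c * y) = c * offset th x y.
Proof.
by move=> c0; rewrite /offset (mulrCA (axis th)) -mulrBr normrM ger0_norm// mulrCA.
Qed.

(** The dilation cancels [20 ^- size th] in [fold_ge]. The loss [- |y|] there is absorbed by
    [y ^+ 2 / 2 >= 2 * |y| - 2], and 10 is this 2 plus the shift 8. *)
Lemma valley_ge th x y :
  `|y| + (4 ^+ size th * `|x - axis th * y|) - 10 <= valley th (x, y).
Proof.
rewrite /valley/=; set L : R := 20 ^+ size th.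
have L0 : 0 < L by rewrite exprn_gt0.
have := fold_ge th (L * x) (L * y); rewrite offset_scale ?(ltW L0)// normrM.
rewrite (ger0_norm (ltW L0)) -mulrBr mulrAC divff ?gt_eqF// mul1r /offset.
have := psi_ge (fold th (L * x) (L * y) - 8).
have := sqr_ge0 x; have := sqr_ge0 (`|y| - 2).
have := real_normK (num_real y); move: `|y| => z zE.
by rewrite -zE => ? ? ? ?; nra.
Qed.

Lemma valley_bottom th x y : offset th x y <= y / 2 ->
  valley th (x, y) = (x ^+ 2 + y ^+ 2) / 2 /\ `|x| <= y.
Proof.
rewrite /valley/= => H; set L : R := 20 ^+ size th.
have L0 : 0 < L by rewrite exprn_gt0.
have H' : offset th (L * x) (L * y) <= L * y / 2.
  by rewrite offset_scale ?(ltW L0)// -mulrA ler_wpM2l// ltW.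
have [f1 xy] := fold_le1 H'; split.
  by rewrite psi_eq0 ?addr0//; lra.
by move: xy; rewrite normrM (ger0_norm (ltW L0)) ler_pM2l.
Qed.

Definition cone th : set (plane R) :=
  [set p | 0 < p.2 /\ offset th p.1 p.2 < p.2].

(** A common point of two cones would put their axes at distance less than [2 * 4 ^- size th],
    against [axis_separated]. *)
Lemma cone_inj th th' p : size th = size th' -> cone th p -> cone th' p ->
  th = th'.
Proof.
move: p => [a b] sth [/= p0 h] [_ /= h'].
apply/eqP/negPn/negP => /(axis_separated (R := R) sth).
move: h h'; rewrite /offset -sth; set k : R := 4 ^+ _.
have k0 : 0 < k by rewrite exprn_gt0.
move=> h h' H.
have : k * (`|axis th - axis th'| * b) <
    2 * b.
  rewrite -[X in _ * (_ * X) < _](ger0_norm (ltW p0)) -normrM.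
  rewrite (_ : (axis th - axis th') * b = - (a - axis th * b) + (a - axis th' * b));
    last by ring.
  have := ler_normD (- (a - axis th * b)) (a - axis th' * b).
  by rewrite normrN => /(ler_wpM2l (ltW k0)); lra.
by rewrite mulrA ltr_pM2r// ltNge H.
Qed.

End Valley.

Section Mass.
Context {R : realType}.
Implicit Types (th : seq bool) (x y : R).
Local Notation mu := (@lebesgue_measure R).

Lemma integral_laplace : (\int[mu]_t (expR (- `|t|))%:E = 2%:E)%E.
Proof.
rewrite ge0_symfun_integralT.
- rewrite (_ : integral _ _ _ = 1%E) ?mule1//.
  rewrite -(@integral_exponential_pdf R 1 ltr01) -set_itvcy integral_mkcond.
  apply: eq_integral => t _; rewrite /exponential_pdf !patchE.
  case: ifPn => //; rewrite inE/= in_itv/= andbT => t0.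
  by rewrite ger0_norm// mul1r mulN1r.
- by move=> t; exact: expR_ge0.
- move=> t; apply: continuous_comp; last exact: continuous_expR.
  by apply: cvgN; exact: norm_continuous.
- by move=> t /=; rewrite normrN.
Qed.

Lemma integral_laplace_affine (s a : R) : 0 < s ->
  (\int[mu]_t (expR (- (s * `|t - a|)))%:E = (2 / s)%:E)%E.
Proof.
move=> s0; pose F t := s * (t - a).
have dF (t : R) : is_derive t 1 F s.
  have D := is_deriveZ s (is_deriveB (is_derive_id t (1 : R)) (is_derive_cst a t 1)).
  by apply: is_derive_eq D _; rewrite subr0 /GRing.scale/= mulr1.
have F'E : F^`()%classic = cst s.
  by apply/funext => t; rewrite derive1E; have [_ ->] := dF t.
have mexp : measurable_fun [set: R] (fun t : R => expR (- (s * `|t - a|))).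
  apply: measurableT_comp => //; apply: measurableT_comp => //.
  apply: measurable_funM => //; apply: measurableT_comp => //.
  exact: measurable_funB.
have := integral_laplace.
rewrite (@increasing_ge0_integration_by_substitutionT _ F) ?F'E.
- under eq_integral.
    move=> t _; rewrite !fctE/= /F normrM (gtr0_norm s0) EFinM.
    over.
  rewrite ge0_integralZr//=; last 2 first.
    exact/measurable_EFinP.
    by rewrite lee_fin ltW.
  move=> /(congr1 (fun z => z * (s^-1)%:E)%E).
  rewrite -muleA -EFinM mulfV ?gt_eqF// mule1 => ->.
  by rewrite -EFinM.
- by move=> x y xy; rewrite /F ltr_pM2l// ltrD2r.
- exact: cst_continuous.
- exact: is_cvg_cst.
- exact: is_cvg_cst.
- by move=> t; have [] := dF t.
- apply/cvgrNyPle => A; near=> t; rewrite /F -ler_pdivlMl// lerBlDr.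
  by near: t; apply: nbhs_ninfty_le; exact: num_real.
- apply/cvgryPge => A; near=> t; rewrite /F -ler_pdivrMl// lerBrDr.
  by near: t; apply: nbhs_pinfty_ge; exact: num_real.
- move=> t; apply: continuous_comp; last exact: continuous_expR.
  by apply: cvgN; exact: norm_continuous.
- by move=> t; exact: expR_ge0.
Unshelve. all: by end_near. Qed.

Lemma measurable_fold d (T : measurableType d) th (f1 f2 : T -> R) :
  measurable_fun [set: T] f1 -> measurable_fun [set: T] f2 ->
  measurable_fun [set: T] (fun t => fold th (f1 t) (f2 t)).
Proof.
have mpsi : measurable_fun [set: R] (@psi R).
  exact: continuous_measurable_fun psi_continuous.
have mc (c : R) (f : T -> R) : measurable_fun [set: T] f ->
  measurable_fun [set: T] (fun t => c * f t) by move=> mf; exact: measurable_funM.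
have mN (f : T -> R) : measurable_fun [set: T] f ->
  measurable_fun [set: T] (fun t => - f t) by move=> mf; exact: measurableT_comp.
move=> + mf2; elim: th f1 => [|b th IH] f1 mf1 /=.
  by apply: measurable_funD; apply: measurableT_comp => //;
    apply: measurable_funB => //; [exact: mc|exact: mN|exact: mc].
apply: measurable_funD; last first.
  apply: measurable_funM => //; apply: (IH (fun t => zoom b (f1 t) (f2 t))).
  rewrite /zoom; apply: (mc _); apply: measurable_funB => //.
  by apply: measurable_funM => //; exact: mc.
apply: (mc _); apply: measurable_funD; apply: measurableT_comp => //.
  by apply: measurable_funB; [exact: mN|exact: mc].
by apply: measurable_funB; exact: mc.
Qed.

Lemma measurable_valley th : measurable_fun [set: plane R] (valley th).
Proof.
have m1 : measurable_fun [set: plane R] (fun p : plane R => p.1 : R).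
  exact: measurable_fst.
have m2 : measurable_fun [set: plane R] (fun p : plane R => p.2 : R).
  exact: measurable_snd.
apply: measurable_funD.
  by apply: measurable_funM => //; apply: measurable_funD;
    exact: measurable_funX.
apply: measurableT_comp; first exact: continuous_measurable_fun psi_continuous.
by apply: measurable_funB => //; apply: measurable_fold; apply: measurable_funM.
Qed.

Lemma measurable_offset th : measurable_fun [set: plane R]
  (fun p : plane R => offset th p.1 p.2).
Proof.
have m1 : measurable_fun [set: plane R] (fun p : plane R => p.1 : R).
  exact: measurable_fst.
have m2 : measurable_fun [set: plane R] (fun p : plane R => p.2 : R).
  exact: measurable_snd.
apply: measurable_funM => //; apply: measurableT_comp => //.
by apply: measurable_funB => //; exact: measurable_funM.
Qed.

Lemma measurable_cone th : measurable (cone (R := R) th).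
Proof.
have m2 : measurable_fun [set: plane R] (fun p : plane R => p.2 : R).
  exact: measurable_snd.
have ltE (f g : plane R -> R) : measurable_fun [set: plane R] f ->
    measurable_fun [set: plane R] g -> measurable [set p : plane R | f p < g p].
  move=> /measurable_EFinP mf /measurable_EFinP mg.
  have := measurable_lte measurableT mf mg; rewrite setTI.
  by congr measurable; apply/seteqP; split => p /=; rewrite lte_fin.
have -> : cone th = [set p : plane R | 0 < p.2] `&`
    [set p : plane R | offset th p.1 p.2 < p.2] by [].
by apply: measurableI; apply: ltE => //; exact: measurable_offset.
Qed.

(** By [valley_ge] the density is dominated by a product of two Laplace profiles; integrating in [x]
    first gives [2 / q], then in [y] gives 2. *)
Lemma gibbs_weight_valley_le th :
  (gibbs_weight (valley th) [set: plane R] <=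
    (4 * expR 10 / 4 ^+ size th)%:E)%E.
Proof.
set q : R := 4 ^+ size th; have q0 : 0 < q by rewrite exprn_gt0.
have m1 : measurable_fun [set: plane R] (fun p : plane R => p.1 : R).
  exact: measurable_fst.
have m2 : measurable_fun [set: plane R] (fun p : plane R => p.2 : R).
  exact: measurable_snd.
have mexp d (T : measurableType d) (f : T -> R) : measurable_fun [set: T] f ->
  measurable_fun [set: T] (fun t => expR (f t)) by move=> mf; exact: measurableT_comp.
pose F (p : plane R) : R :=
  expR 10 * expR (- `|p.2|) * expR (- (q * `|p.1 - axis th * p.2|)).
have mF : measurable_fun [set: plane R] (fun p => (F p)%:E).
  apply/measurable_EFinP; apply: measurable_funM.
    apply: measurable_funM => //; apply: (mexp _ _ (fun p : plane R => - `|p.2|)).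
    by apply: measurableT_comp => //; exact: measurableT_comp.
  apply: (mexp _ _ (fun p : plane R => - (q * `|p.1 - axis th * p.2|))).
  by apply: measurableT_comp => //; exact: measurable_offset.
have F0 p : (0 <= (F p)%:E)%E.
  by rewrite lee_fin !mulr_ge0// expR_ge0.
apply: (@le_trans _ _ (\int[mu \x mu]_p (F p)%:E)%E).
  apply: ge0_le_integral.
  - exact: measurableT.
  - by move=> p _; rewrite lee_fin expR_ge0.
  - apply/measurable_EFinP; apply: (mexp _ _ (fun p : plane R => - valley th p)).
    by apply: measurableT_comp => //; exact: measurable_valley.
  - exact: mF.
  - move=> [x y] _; rewrite lee_fin /F -!expRD ler_expR/=.
    by have := valley_ge th x y; rewrite -/q; lra.
have int1 y : (\int[mu]_x (F (x, y))%:E =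
    (expR 10 * (2 / q))%:E * (expR (- `|y|))%:E)%E.
  under eq_integral do rewrite /F/= EFinM.
  rewrite ge0_integralZl//=.
  - by rewrite integral_laplace_affine// -!EFinM mulrAC.
  - apply/measurable_EFinP; apply: (mexp _ _ (fun x : R => - (q * `|x - axis th * y|))).
    apply: measurableT_comp => //; apply: measurable_funM => //.
    by apply: measurableT_comp => //; exact: measurable_funB.
rewrite fubini_tonelli2// (_ : integral _ _ _ =
    \int[mu]_y ((expR 10 * (2 / q))%:E * (expR (- `|y|))%:E))%E; last first.
  by apply: eq_integral => y _; exact: int1.
rewrite ge0_integralZl//=; last 2 first.
- apply/measurable_EFinP; apply: (mexp _ _ (fun y : R => - `|y|)).
  exact: measurableT_comp.
- by rewrite lee_fin mulr_ge0 ?expR_ge0// divr_ge0// ltW.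
rewrite integral_laplace -EFinM lee_fin.
by lra.
Qed.

(** The parallelogram [1 <= y <= 2], [|x - axis th * y| <= 1 / (2 * q)] has area [1 / q]. It lies in
    the flat part of the cone, where the potential is [|p|^2 / 2 <= 4] because [|x| <= y <= 2]. *)
Lemma gibbs_weight_cone_ge th :
  ((expR (- 4) / 4 ^+ size th : R)%:E <=
    gibbs_weight (valley th) (cone th))%E.
Proof.
set q : R := 4 ^+ size th; have q0 : 0 < q by rewrite exprn_gt0.
have m1 : measurable_fun [set: plane R] (fun p : plane R => p.1 : R).
  exact: measurable_fst.
have m2 : measurable_fun [set: plane R] (fun p : plane R => p.2 : R).
  exact: measurable_snd.
pose I1 : set R := `[1, 2]%classic.
pose I2 : set R := `[- (2 * q)^-1, (2 * q)^-1]%classic.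
have mI (I : interval R) d (T : measurableType d) (f : T -> R) :
    measurable_fun [set: T] f ->
    measurable_fun [set: T] (fun t => \1_([set` I] : set R) (f t) : R).
  by move=> mf; apply: measurableT_comp => //; exact: measurable_indic.
pose F (p : plane R) : R := expR (- 4) * \1_I1 p.2 * \1_I2 (p.1 - axis th * p.2).
have mF : measurable_fun [set: plane R] (fun p => (F p)%:E).
  apply/measurable_EFinP; apply: measurable_funM.
    by apply: measurable_funM => //; exact: (mI _ _ _ (fun p : plane R => p.2)).
  apply: (mI _ _ _ (fun p : plane R => p.1 - axis th * p.2)).
  by apply: measurable_funB => //; exact: measurable_funM.
have F0 p : (0 <= (F p)%:E)%E.
  by rewrite lee_fin !mulr_ge0// expR_ge0.
apply: (@le_trans _ _ (\int[mu \x mu]_p (F p)%:E)%E); last first.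
  rewrite /gibbs_weight [leRHS]integral_mkcond; apply: ge0_le_integral.
  - exact: measurableT.
  - by [].
  - exact: mF.
  - apply/(measurable_restrictT _ (measurable_cone th)).
    apply: measurable_funTS; apply/measurable_EFinP.
    apply: measurableT_comp => //; apply: measurableT_comp => //.
    exact: measurable_valley.
  - move=> [x y] _; rewrite patchE /F/= !indicE.
    have [yI|_] := boolP (y \in I1); last first.
      by rewrite mulr0 mul0r; case: ifPn => // _; rewrite lee_fin expR_ge0.
    have [xI|_] := boolP (_ \in I2); last first.
      by rewrite !mulr0; case: ifPn => // _; rewrite lee_fin expR_ge0.
    move: yI xI; rewrite !inE /I1 /I2/= !in_itv/= -ler_norml => /andP[y1 y2] xI.
    have oy : offset th x y <= 1 / 2.
      by rewrite /offset -/q -ler_pdivlMl//; move: xI; rewrite invfM; lra.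
    have oy2 : offset th x y <= y / 2 by lra.
    have [VE xy] := valley_bottom oy2.
    rewrite ifT; last by rewrite inE; split => /=; lra.
    rewrite !mulr1 lee_fin ler_expR VE lerN2.
    have x2 : `|x| <= 2 by exact: le_trans y2.
    by move: x2; rewrite ler_norml => /andP[? ?]; nra.
have int1 y : (\int[mu]_x (F (x, y))%:E =
    (expR (- 4) / q)%:E * (\1_I1 y)%:E)%E.
  under eq_integral do rewrite /F/= EFinM.
  rewrite ge0_integralZl//=; last first.
    apply/measurable_EFinP; apply: (mI _ _ _ (fun x : R => x - axis th * y)).
    exact: measurable_funB.
  rewrite (_ : integral _ _ _ = \int[mu]_x (\1_(`[axis th * y - (2 * q)^-1,
      axis th * y + (2 * q)^-1]%classic : set R) x)%:E)%E; last first.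
    apply: eq_integral => x _; rewrite !indicE /I2; congr (_%:R%:E); congr nat_of_bool.
    by apply/idP/idP; rewrite !inE/= !in_itv/= => /andP[? ?]; apply/andP; split; lra.
  have q2 : 0 < (2 * q)^-1 by rewrite invr_gt0 mulr_gt0.
  rewrite integral_indic//= setIT lebesgue_measure_itv/= lte_fin ltrD2l gtrN//.
  rewrite -EFinD -!EFinM; congr EFin; field; rewrite gt_eqF//.
rewrite fubini_tonelli2// (_ : integral _ _ _ =
    \int[mu]_y ((expR (- 4) / q)%:E * (\1_I1 y)%:E))%E; last first.
  by apply: eq_integral => y _; exact: int1.
rewrite ge0_integralZl//=; last 2 first.
- by apply/measurable_EFinP; exact: (mI _ _ _ (fun x : R => x)).
- by rewrite lee_fin mulr_ge0 ?expR_ge0// invr_ge0 ltW.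
rewrite /I1 integral_indic//= setIT lebesgue_measure_itv/= lte_fin ltr1n/=.
by rewrite -EFinD -EFinM lee_fin; lra.
Qed.

Lemma gibbs_cone_ge th : ((expR (- 14) / 4 : R)%:E <= gibbs (valley th) (cone th))%E.
Proof.
have := gibbs_weight_cone_ge th; have := gibbs_weight_valley_le th.
have : (gibbs_weight (valley th) (cone th) <=
    gibbs_weight (valley th) [set: plane R])%E.
  apply: ge0_subset_integral => //; first exact: measurable_cone.
  apply/measurable_EFinP; apply: measurableT_comp => //.
  by apply: measurableT_comp => //; exact: measurable_valley.
rewrite /gibbs; set q : R := 4 ^+ size th; have q0 : 0 < q by rewrite exprn_gt0.
move: (gibbs_weight _ [set: plane R]) (gibbs_weight _ (cone th)).
(* The upper bound makes the total weight finite, so [fine] is harmless; the lower bound makes it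
   positive. The factor [q] then cancels in the quotient. *)
move=> [z| |] [z'| |]//=; rewrite ?lee_fin// => z'z zle z'ge.
have e4 : 0 < expR (- 4) / q by rewrite divr_gt0 ?expR_gt0.
have z0 : 0 < z by lra.
rewrite [leRHS]mulrC ler_pdivlMr// (le_trans _ z'ge)//.
have a0 : 0 <= expR (- 14) / 4 :> R by rewrite divr_ge0 ?expR_ge0.
have abE (a b : R) : a / 4 * (4 * b / q) = a * b / q.
  by field; rewrite gt_eqF.
rewrite (le_trans (ler_wpM2l a0 zle))// abE -expRD.
by rewrite (_ : -14 + 10 = -4 :> R)//; lra.
Qed.

End Mass.

(** * Valleys are admissible potentials *)

Section PotentialClass.
Context {R : realType}.
Implicit Types (f g : R * R -> R) (p q : R * R) (th pre s t : seq bool).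

Lemma has_grad_C2 f f1 f2 : has_grad f f1 f2 -> cont_grad f1 -> cont_grad f2 ->
  C2 f.
Proof.
move=> gf cf1 cf2; have [h1 h2 e1 e2] := has_grad_derive gf.
have c1 := cont_grad_continuous cf1; have c2 := cont_grad_continuous cf2.
split; [|rewrite e1|rewrite e2]; [|exact: cont_grad_C1..].
by apply: cont_grad_C1; exists f1, f2.
Qed.

Lemma has_grad_halfsq :
  has_grad (fun p : R * R => (p.1 ^+ 2 + p.2 ^+ 2) / 2) fst snd.
Proof.
have g1 := has_grad_lin (1 : R) 0; have g2 := has_grad_lin (0 : R) 1.
have := has_gradM (has_gradD (has_gradM g1 g1) (has_gradM g2 g2))
  (has_grad_cst 2^-1).
rewrite (_ : (fun p => _ * _) = (fun p => (p.1 ^+ 2 + p.2 ^+ 2) / 2)); last first.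
  by apply/funext => p; congr (_ / _); ring.
by move=> H p; apply: (is_diff_eq (H p)); apply/funext => v; field.
Qed.

Lemma enorm_sqr p : enorm p ^+ 2 = p.1 ^+ 2 + p.2 ^+ 2.
Proof. by rewrite sqr_sqrtr// addr_ge0// sqr_ge0. Qed.

Lemma dist1_le_enorm p q : dist1 p q <= 2 * enorm (p - q).
Proof.
have h (a b : R) : `|a| <= Num.sqrt (a ^+ 2 + b ^+ 2).
  by rewrite -sqrtr_sqr ler_wsqrtr// lerDl sqr_ge0.
rewrite /dist1 /enorm; have := h (p - q).1 (p - q).2.
have := h (p - q).2 (p - q).1; rewrite (addrC ((p - q).2 ^+ 2)).
by move: (Num.sqrt _) => z /=; lra.
Qed.

Lemma enorm_le p : enorm p <= `|p.1| + `|p.2|.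
Proof.
rewrite -[leRHS]ger0_norm ?addr_ge0// -sqrtr_sqr ler_wsqrtr//.
rewrite sqrrD !real_normK ?num_real//.
by have := normr_ge0 p.1; have := normr_ge0 p.2; nra.
Qed.

Lemma valley0 th : valley th (0 : R * R) = 0.
Proof.
rewrite /valley/= !mulr0 !expr0n/= addr0 mul0r add0r psi_eq0//.
by have := fold_le th (0 : R) 0; rewrite normr0; lra.
Qed.

Lemma regular_ravine th (L : R) : 0 <= L ->
  regular (5 / 2 * L) (17 * L ^+ 2)
    (fun p => psi (fold th (L * p.1) (L * p.2) - 8)).
Proof.
move=> L0; have := @regular_fold R th L 0 L L.
rewrite normr0 add0r ger0_norm// lexx => /(_ isT isT) /(regularDcst (-8)).
rewrite (_ : (fun p => _ + _) = (fun p => fold th (L * p.1) (L * p.2) - 8)); last first.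
  by apply/funext => p; rewrite mul0r addr0.
move=> /regular_psi; rewrite mulr_ge0// => /(_ isT).
by apply: regular_le => //; nra.
Qed.

(** The quadratic part is exactly 1-strongly convex, and the remainder is convex as [psi] is convex
    and nondecreasing. With [L = 20 ^+ size th], the comparison of norms gives smoothness
    [4 * (1 + 17 * L ^+ 2)], below [400 * L ^+ 2 = 400 ^+ (size th).+1]. *)
Lemma valley_in_class th (kappa : R) : 400 ^+ (size th).+1 <= kappa ->
  potential_class kappa (valley th).
Proof.
pose L : R := 20 ^+ size th.
have L1 : 1 <= L by rewrite exprn_ege1// ler1n.
have L0 : 0 <= L by exact: le_trans L1.
rewrite exprS (_ : 400 ^+ _ = L ^+ 2); last first.
  by rewrite /L -exprM mulnC exprM; congr (_ ^+ _); ring.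
move=> kL; have [r1 [r2 [gr [c1 c2] _ _ [l1 l2]]]] := regular_ravine th L0.
have gV := has_gradD has_grad_halfsq gr.
have cfst : cont_grad (fst : R * R -> R).
  have := has_grad_lin (1 : R) 0.
  rewrite (_ : (fun p => _) = fst); last by apply/funext => p; ring.
  by exists (fun=> 1), (fun=> 0); split => //; exact: cst_continuous.
have csnd : cont_grad (snd : R * R -> R).
  have := has_grad_lin (0 : R) 1.
  rewrite (_ : (fun p => _) = snd); last by apply/funext => p; ring.
  by exists (fun=> 0), (fun=> 1); split => //; exact: cst_continuous.
have [_ _ e1 e2] := has_grad_derive gV.
split.
- by apply: (has_grad_C2 gV); apply: cont_gradD.
- move=> [x1 x2] [y1 y2] s s0 s1; rewrite enorm_sqr /valley/= -/L.
  have := fold_convex th (L * x1) (L * x2) (L * y1) (L * y2) s0 s1.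
  rewrite (_ : s * (L * x1) + _ = L * (s * x1 + (1 - s) * y1)); last by ring.
  rewrite (_ : s * (L * x2) + _ = L * (s * x2 + (1 - s) * y2)); last by ring.
  move=> fc.
  have := psi_convex (fold th (L * x1) (L * x2) - 8)
    (fold th (L * y1) (L * y2) - 8) s0 s1.
  set a := fold _ (L * x1) _ in fc *; set b := fold _ (L * y1) _ in fc *.
  have : psi (fold th (L * (s * x1 + (1 - s) * y1)) (L * (s * x2 + (1 - s) * y2)) - 8)
      <= psi (s * (a - 8) + (1 - s) * (b - 8)) by apply: psi_homo; lra.
  rewrite /GRing.scale/=; move: (psi (a - 8)) (psi (b - 8)) (psi _) (psi _) => A B C D.
  by lra.
- move=> p q.
  rewrite (le_trans (enorm_le _))// /grad /= e1 e2.
  apply: (@le_trans _ _ (2 * (dist1 p q + 17 * L ^+ 2 * dist1 p q))).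
    have := l1 p q; have := l2 p q.
    have := ler_normD (p.1 - q.1) (r1 p - r1 q).
    have := ler_normD (p.2 - q.2) (r2 p - r2 q).
    rewrite (_ : p.1 + r1 p - _ = p.1 - q.1 + (r1 p - r1 q)); last by ring.
    rewrite (_ : p.2 + r2 p - _ = p.2 - q.2 + (r2 p - r2 q)); last by ring.
    rewrite /dist1.
    by have := normr_ge0 (p.1 - q.1); have := normr_ge0 (p.2 - q.2); lra.
  have := dist1_le_enorm p q; have := dist1_ge0 p q.
  have : 1 <= L ^+ 2 by rewrite exprn_ege1.
  move: (dist1 p q) (enorm _) (L ^+ 2) kL => d e M; nra.
- by move=> p; rewrite valley0 addr_ge0 ?psi_ge0// divr_ge0// addr_ge0// sqr_ge0.
Qed.

(** Value and gradient are local at [p]; the normalization at the origin, possibly far from [p],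
    agrees because all valleys vanish there. *)
Lemma near_eq_oracle s t p : {near p, valley s =1 valley t} ->
  oracle (valley s) p = oracle (valley t) p.
Proof.
move=> st; rewrite /oracle !valley0 (nbhs_singleton st) /grad /d1 /d2.
by rewrite (near_eq_derive _ st) (near_eq_derive _ st).
Qed.

Lemma valley_blind_child pre d p : exists b, forall s t,
  size s = d -> size t = d ->
  oracle (valley (pre ++ b :: s)) p = oracle (valley (pre ++ b :: t)) p.
Proof.
pose L : R := 20 ^+ (size pre + d.+1).
have sz b s : size s = d -> 20 ^+ size (pre ++ b :: s) = L.
  by move=> sd; rewrite size_cat/= sd.
have cfst : {for p, continuous (fun q : R * R => L * q.1)}.
  by apply: cvgM; [exact: cvg_cst|exact: cvg_fst].
have csnd : {for p, continuous (fun q : R * R => L * q.2)}.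
  by apply: cvgM; [exact: cvg_cst|exact: cvg_snd].
have [[X1 Y1]|[b H]] := blind_or_core pre (L * p.1) (L * p.2); last first.
  exists b => s t sd td; apply: near_eq_oracle.
  have := blind_near cfst csnd H; apply: filterS => q bq.
  by rewrite /valley !sz// (blind_eq s t bq).
(* Near the core the dilated coordinates stay below [5 / 4], so [fold] is at most 7 and both valleys
   are the plain quadratic; either bit would do. *)
exists true => s t sd td; apply: near_eq_oracle.
have n1 : \forall q \near p, `|L * q.1| < 5 / 4.
  apply: (cvgr_norm_lt _ cfst); lra.
have n2 : \forall q \near p, `|L * q.2| < 5 / 4.
  apply: (cvgr_norm_lt _ csnd); lra.
near=> q.
have q1 : `|L * q.1| < 5 / 4 by near: q.
have q2 : `|L * q.2| < 5 / 4 by near: q.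
by rewrite /valley !sz// !psi_eq0//;
  [have := fold_le (pre ++ true :: t) (L * q.1) (L * q.2)
  |have := fold_le (pre ++ true :: s) (L * q.1) (L * q.2)]; lra.
Unshelve. all: by end_near. Qed.

End PotentialClass.

(** * The lower bound *)

Section LowerBound.
Context {R : realType}.
Implicit Types (th : seq bool).

(** The total variation bound is tested on the single event [cone th]. *)
Lemma samples_within_cone d (Omega : measurableType d) (P : probability Omega R)
    (alg : query_algorithm R Omega) n th (kappa eps : R) :
  400 ^+ (size th).+1 <= kappa -> samples_within P alg n kappa eps ->
  measurable (run alg (valley th) n @^-1` cone th) /\
  ((expR (- 14) / 4 - eps)%:E <= P (run alg (valley th) n @^-1` cone th))%E.
Proof.
move=> hk /(_ _ (valley_in_class hk))[mrun tv].
have mA : measurable (run alg (valley th) n @^-1` cone th).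
  by rewrite -[X in measurable X]setTI; apply: mrun => //; exact: measurable_cone.
split => //.
have : (`|P (run alg (valley th) n @^-1` cone th) -
    gibbs (valley th) (cone th)| <= eps%:E)%E.
  apply: le_trans tv; apply: ereal_sup_ubound.
  by exists (cone th) => //; exact: measurable_cone.
have := gibbs_cone_ge (R := R) th.
rewrite -(fineK (fin_num_measure P _ mA)); move: (fine _) => a.
case: (gibbs _ _) => [g| |]//=; rewrite ?lee_fin// => h.
by rewrite ler_norml => /andP[h1 h2]; lra.
Qed.

(** Passes from a count valid for each fixed seed, where the algorithm is deterministic, to
    probabilities, by integrating the sum of indicators. *)
Lemma sum_prob_le d (Omega : measurableType d) (P : probability Omega R)
    (T : Type) (s : seq T) (A : T -> set Omega) (C : R) :
  (forall x, measurable (A x)) ->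
  (forall w, \sum_(x <- s) \1_(A x) w <= C) ->
  (\sum_(x <- s) P (A x) <= C%:E)%E.
Proof.
move=> mA sC; under eq_bigr do rewrite -[A _]setIT -integral_indic//.
have mI x : measurable_fun [set: Omega] (fun w => (\1_(A x) w : R)%:E).
  by apply/measurable_EFinP; exact: measurable_indic.
rewrite -ge0_integral_sum//.
apply: (@le_trans _ _ (\int[P]_w (cst C%:E w))%E); last first.
  by rewrite integral_cst//= probability_setT mule1.
apply: ge0_le_integral => //.
- by move=> w _; apply: sume_ge0.
- exact: emeasurable_sum.
- by move=> w _; rewrite sumEFin lee_fin.
Qed.

Lemma cone_count d (Omega : measurableType d) (alg : query_algorithm R Omega) n K w :
  \sum_(th <- words K) \1_(run alg (valley th) n @^-1` cone th) w
    <= 2 ^+ n * (3 / 2) ^+ K :> R.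
Proof.
have inj s t z : size s = size t -> `[< cone (R := R) s z >] -> `[< cone t z >] -> s = t.
  by move=> st /asboolP hs /asboolP; exact: cone_inj.
have := count_hits alg w inj (@valley_blind_child R) n [::] K [::].
set c := count _ _ => H.
have -> : \sum_(th <- words K) \1_(run alg (valley th) n @^-1` cone th) w = c%:R :> R.
  rewrite /c -sum1_count natr_sum [RHS]big_mkcond; apply: eq_bigr => th _.
  rewrite indicE (_ : (w \in _) = `[< cone th (run alg (valley th) n w) >]).
    by rewrite /run; case: ifP.
  by apply/idP/asboolP; rewrite inE.
rewrite expr_div_n mulrA ler_pdivlMr ?exprn_gt0//.
by rewrite -!natrX -!natrM ler_nat.
Qed.

(** Double counting over the [2 ^ K] words: each is identified with probability at least
    [expR (- 14) / 4 - eps], yet every seed identifies at most [2 ^ n (3 / 2) ^ K] of them. *)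
Lemma success_bound d (Omega : measurableType d) (P : probability Omega R)
    (alg : query_algorithm R Omega) n K (kappa eps : R) :
  400 ^+ K.+1 <= kappa -> samples_within P alg n kappa eps ->
  (4 / 3) ^+ K * (expR (- 14) / 4 - eps) <= 2 ^+ n.
Proof.
(* Words of another length receive [set0], since [sum_prob_le] requires measurability at every
   index. *)
move=> hk hs; pose A th : set Omega :=
  if size th == K then run alg (valley th) n @^-1` cone th else set0.
have mA th : measurable (A th).
  rewrite /A; case: eqP => // sth.
  by have [] := @samples_within_cone _ _ P alg n th kappa eps _ hs; rewrite ?sth.
have AE th : th \in words K -> A th = run alg (valley th) n @^-1` cone th.
  by rewrite /A mem_words => ->.
have sumA : (\sum_(th <- words K) P (A th) <= (2 ^+ n * (3 / 2) ^+ K)%:E)%E.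
  apply: sum_prob_le => // w; apply: le_trans (cone_count alg n K w).
  by rewrite le_eqVlt; apply/orP; left; apply/eqP/eq_big_seq => th /AE ->.
have sumA' : (\sum_(th <- words K) (expR (- 14) / 4 - eps)%:E <=
    \sum_(th <- words K) P (A th))%E.
  rewrite big_seq [leRHS]big_seq; apply: lee_sum => th thK; rewrite AE//.
  move: thK; rewrite mem_words => /eqP sth.
  by have [] := @samples_within_cone _ _ P alg n th kappa eps _ hs; rewrite ?sth.
have := le_trans sumA' sumA.
rewrite sumEFin lee_fin big_const_seq count_predT size_words iter_addr_0.
rewrite -[leLHS]mulr_natl natrX => H.
have k0 : 0 < (3 / 2) ^+ K :> R by rewrite exprn_gt0// divr_gt0.
rewrite -(ler_pM2r k0) mulrAC -exprMn (_ : 4 / 3 * (3 / 2) = 2)//.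
by field.
Qed.

Lemma le_ln_exp (a b : R) m : 0 < a -> 0 < b -> a <= b ^+ m ->
  ln a <= m%:R * ln b.
Proof.
move=> a0 b0 ab; rewrite mulr_natl -lnXn//.
by rewrite ler_ln ?posrE ?exprn_gt0.
Qed.

End LowerBound.

Theorem theorem4 (R : realType) :
  exists eps0 c kappa0 : R,
    [/\ 0 < eps0, 0 < c, 1 <= kappa0
      & forall kappa : R, kappa0 <= kappa ->
        forall (d : measure_display) (Omega : measurableType d)
          (P : probability Omega R) (alg : query_algorithm R Omega) (n : nat),
          samples_within P alg n kappa eps0 -> c * ln kappa <= n%:R].
Proof.
(* Half of the guaranteed cone mass, so that [del] itself remains after subtracting the accuracy. *)
pose del : R := expR (- 14) / 8.
have del0 : 0 < del by apply: divr_gt0; [exact: expR_gt0|rewrite ltr0n].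
have B1 : 1 < 400 :> R by rewrite ltr1n.
have B0 : 0 < 400 :> R by rewrite ltr0n.
have X0 m : 0 < 400 ^+ m :> R := exprn_gt0 m B0.
exists del, (1 / 144), (400 ^+ 137); split; [exact: del0|lra|exact: exprn_ege1 (ltW B1)|].
move=> kappa hkappa d Omega P alg n hs.
have kappa0 : 0 < kappa := lt_le_trans (X0 _) hkappa.
have ex : exists m, kappa < 400 ^+ m.
  exists (Num.bound kappa); apply: lt_le_trans (upper_nthrootP (leqnn _)) _.
  by apply: lerXn2r; [rewrite nnegrE ler0n|rewrite nnegrE ltW|rewrite ler_nat].
have [m hm hmin] := ex_minnP ex.
have m137 : (137 < m)%N.
  rewrite -(ltr_eXn2l B1); exact: le_lt_trans hkappa hm.
(* By minimality [400 ^+ K.+1 <= kappa < 400 ^+ K.+2]: the first bound admits words of length [K],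
   the second bounds [ln kappa]; moreover [K >= 136]. *)
case: m => [//|[//|K]] in hm hmin m137 *.
have hk : 400 ^+ K.+1 <= kappa.
  by rewrite leNgt; apply/negP => /hmin; rewrite ltnn.
have := success_bound hk hs.
have -> : expR (- 14) / 4 - del = del by rewrite /del; field.
have p2 : 0 < 2 :> R by rewrite ltr0n.
have p43 : 0 < 4 / 3 :> R by lra.
have p8 : 0 < 8 :> R by rewrite ltr0n.
have p43K : 0 < (4 / 3) ^+ K :> R := exprn_gt0 K p43.
move=> /(le_ln_exp (mulr_gt0 p43K del0) p2).
rewrite lnM; [|by rewrite posrE..].
rewrite (lnXn K p43) /del ln_div; [|by rewrite posrE ?expR_gt0..].
rewrite expRK -[ln (4 / 3) *+ K]mulr_natr.
have lnk : ln kappa <= K.+2%:R * ln 400 := le_ln_exp kappa0 B0 (ltW hm).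
have ln2 : ln 2 <= 1 :> R.
  by have := @le_ln1Dx R 1; rewrite (_ : 1 + 1 = 2)//; apply; lra.
have ln8 : ln 8 <= 3 * ln 2 :> R.
  by apply: le_ln_exp => //; rewrite -natrX ler_nat.
have ln400 : ln 400 <= 9 * ln 2 :> R.
  by apply: le_ln_exp => //; rewrite -natrX ler_nat.
have ln43 : 1 / 4 <= ln (4 / 3) :> R.
  rewrite (_ : 4 / 3 = (1 - 1 / 4)^-1); last by field.
  rewrite lnV; last by rewrite posrE; lra.
  by have := @le_ln1Dx R (- (1 / 4)); lra.
have k136 : 136 <= K%:R :> R by rewrite ler_nat.
have n0 : 0 <= n%:R :> R by rewrite ler0n.
move: lnk; rewrite -[K.+2]addn2 natrD.
move: (ln 400) (ln 2) (ln 8) (ln (4 / 3)) (ln kappa) K%:R n%:R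
  ln400 ln2 ln8 ln43 k136 n0.
clear=> a b e f l k x ha hb he hf hk hx hl H.
(* The success bound yields [n >= K / 4 - 14 - 3]. As [K >= 136], the loss 17 is at most [K / 8],
   leaving [K / 8 >= (K + 2) / 16 >= ln kappa / 144]. *)
have h1 : l <= 9 * (k + 2) by nra.
have h2 : 1 / 4 * k <= f * k by nra.
have h3 : x * b <= x by nra.
lra.
Qed.
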